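(* Let $G$ be a group and let $\mathrm{ZR}_*(G)$ denote either $\mathrm{ZR}_l(G)$ or $\mathrm{ZR}(G)$. Assume that: (i) for every non-trivial $\preceq\in\mathrm{ZR}_*(G)$, the set $\{\preceq'\in\mathrm{ZR}_*(G)\mid \preceq'\,\boldsymbol{<}\,\preceq\}$ has a maximal element; (ii) for every $\preceq_1,\preceq_2\in\mathrm{ZR}_*(G)$ with $\preceq_1\,\boldsymbol{<}\,\preceq_2$, the set $\{\preceq'\in\mathrm{ZR}_*(G)\mid \preceq_1\,\boldsymbol{<}\,\preceq'\,\boldsymbol{\leq}\,\preceq_2\}$ has a minimal element. Then $\mathrm{ZR}_*(G)$ has a rooted tree structure: the graph whose vertices are the elements of $\mathrm{ZR}_*(G)$, and in which there is an edge between two vertices $\preceq_1,\preceq_2$ if and only if $\preceq_1\,\boldsymbol{<}\,\preceq_2$ or $\preceq_2\,\boldsymbol{<}\,\preceq_1$ and there is no element of $\mathrm{ZR}_*(G)$ strictly between $\preceq_1$ and $\preceq_2$, is a tree, rooted at the trivial preorder $\leq_\emptyset$.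
   Context: A left-invariant preorder on a group $G$ is a binary relation $\preceq$ on $G$ that is total ($u\preceq v$ or $v\preceq u$ for all $u,v\in G$), transitive, and such that $u\preceq v$ implies $wu\preceq wv$ for all $u,v,w\in G$. It is bi-invariant if in addition $u\preceq v$ implies $uw\preceq vw$. $\mathrm{ZR}_l(G)$ is the set of left-invariant preorders on $G$ and $\mathrm{ZR}(G)$ the set of bi-invariant ones. The trivial preorder $\leq_\emptyset$ is the one with $u\leq_\emptyset v$ for all $u,v\in G$. For $\preceq_1,\preceq_2\in\mathrm{ZR}_*(G)$, one writes $\preceq_1\,\boldsymbol{\leq}\,\preceq_2$ (and says that $\preceq_2$ refines $\preceq_1$) if for all $u,v\in G$, $u\preceq_2 v$ implies $u\preceq_1 v$; this is a partial order, and $\preceq_1\,\boldsymbol{<}\,\preceq_2$ means $\preceq_1\,\boldsymbol{\leq}\,\preceq_2$ and $\preceq_1\neq\preceq_2$. A tree is a graph in which any two vertices are joined by a unique (finite) path. *)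

(* Defs.v *)
From mathcomp Require Import all_boot.
From mathcomp Require Import boolp classical_sets.

Set Implicit Arguments.
Unset Strict Implicit.
Unset Printing Implicit Defensive.

Local Open Scope group_scope.
Local Open Scope classical_set_scope.

(* Relations are boolean ([rel]); under the classical axioms of boolp every
   Prop-valued relation is of this form and [=] on [rel G] is extensional. *)

Definition left_invariant (G : groupType) (R : rel G) : Prop :=
  forall u v w : G, R u v -> R (w * u) (w * v).

Definition right_invariant (G : groupType) (R : rel G) : Prop :=
  forall u v w : G, R u v -> R (u * w) (v * w).

Definition left_preorders (G : groupType) : set (rel G) :=
  [set R | [/\ total R, transitive R & left_invariant R]].

Definition bi_preorders (G : groupType) : set (rel G) :=
  [set R | left_preorders R /\ right_invariant R].

Definition trivial_preorder (G : groupType) : rel G := fun _ _ => true.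

Arguments left_preorders G : clear implicits.
Arguments bi_preorders G : clear implicits.
Arguments trivial_preorder G : clear implicits.

(* [refines R1 R2] is R1 <= R2, i.e. R2 refines R1: the finer preorder, which
   has fewer related pairs, is the larger element. *)
Definition refines (T : Type) (R1 R2 : rel T) : Prop := subrel R2 R1.

Definition strictly_refines (T : Type) (R1 R2 : rel T) : Prop :=
  refines R1 R2 /\ R1 <> R2.

Definition maximal_in (T : Type) (lt : T -> T -> Prop) (A : set T) (x : T) :
    Prop :=
  A x /\ forall y, A y -> ~ lt x y.

Definition minimal_in (T : Type) (lt : T -> T -> Prop) (A : set T) (x : T) :
    Prop :=
  A x /\ forall y, A y -> ~ lt y x.

Definition covering_edge (T : Type) (lt : T -> T -> Prop) (V : set T)
    (x y : T) : Prop :=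
  (lt x y \/ lt y x) /\
  ~ (exists2 z, V z & (lt x z /\ lt z y) \/ (lt y z /\ lt z x)).

(* The successive vertices of the path are those of [x :: p]; [p = [::]] is the
   path of length 0. *)
Definition graph_path (T : eqType) (V : set T) (E : T -> T -> Prop) (x y : T)
    (p : seq T) : Prop :=
  [/\ {in x :: p, forall z, V z}, path (fun a b => `[< E a b >]) x p,
      last x p = y & uniq (x :: p)].

Definition is_tree (T : eqType) (V : set T) (E : T -> T -> Prop) : Prop :=
  [/\ (forall x y, E x y -> E y x), (forall x, ~ E x x) &
      forall x y, V x -> V y -> exists! p, graph_path V E x y p].

Definition is_rooted_tree (T : eqType) (V : set T) (E : T -> T -> Prop)
    (r : T) : Prop :=
  V r /\ is_tree V E.

(* Main.v *)
Require Import Defs.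
From mathcomp Require Import all_boot.
From mathcomp Require Import boolp classical_sets.

Set Implicit Arguments.
Unset Strict Implicit.
Unset Printing Implicit Defensive.

(** Two preorders coarser than a common left-invariant preorder [R] are
    comparable, because each is determined by its elements preceding 1, which
    form an initial segment of [R] ([coarser_preorders_comparable]).  Hence the
    elements of [ZR] below a given one form a chain, with the trivial preorder
    at the bottom.  The cover relation of such an order is automatically a
    forest: an edge that leaves the set of elements above [x] has to leave it
    through [x] and go to the unique predecessor of [x] ([edge_exit]).  So the
    first step of a simple path is forced by its endpoints
    ([path_stays_above], [path_stays_outside]), and simple paths are unique
    ([simple_path_unique]).

    The substantial point is connectedness: every preorder must be joined to the
    trivial one by a finite path.  Existence of predecessors and successors is
    not enough for this, as the order type omega + omega* shows.  What excludes
    it is completeness: the intersection of a family of preorders coarser than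
    [z] is again a preorder, since it contains the total relation [z], and it is
    the supremum of the family ([bounded_preorders_have_sup]).  Unless it is
    trivial, the supremum has a predecessor, which is no longer an upper bound
    of the family; so the supremum is attained ([bounded_set_has_max]).  Apply
    this to the elements below [x] that are joined to the root by a finite path.
    If their maximum were not [x], then its successor towards [x] would be a
    larger such element; so [x] itself is joined to the root
    ([root_connected]). *)

Local Open Scope classical_set_scope.

(** * Cover graphs of orders whose lower sets are chains *)

Section CoverGraph.

Context (T : eqType) (le : T -> T -> Prop) (V : set T) (r : T).

Definition strict_part (x y : T) : Prop := le x y /\ x <> y.

Definition covered_by (x y : T) : Prop :=
  strict_part x y /\ ~ exists2 z, V z & strict_part x z /\ strict_part z y.

Definition joined (x y : T) : Prop :=
  exists p : seq T, [/\ {in x :: p, forall z, V z},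
    path (fun a b => `[< covering_edge strict_part V a b >]) x p & last x p = y].

Hypothesis le_refl : forall x, le x x.
Hypothesis le_trans : forall x y z, le x y -> le y z -> le x z.
Hypothesis le_anti : forall x y, le x y -> le y x -> x = y.
Hypothesis lower_chain : forall x y z, V x -> V y -> V z ->
  le x z -> le y z -> le x y \/ le y x.

Local Notation lt := strict_part.
Local Notation edge := (covering_edge strict_part V).

Lemma lt_asym x y : lt x y -> ~ lt y x.
Proof. by move=> [xy nxy] [yx _]; apply: nxy; apply: le_anti. Qed.

Lemma covering_edgeP x y : edge x y <-> covered_by x y \/ covered_by y x.
Proof.
split.
  by case=> -[xy|yx] nb; [left|right]; split=> // -[z Vz bz];
    apply: nb; exists z => //; [left|right].
have down u v z : lt u v -> lt v z -> ~ lt z u.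
  move=> uv vz zu; apply: (lt_asym zu).
  split; first exact: le_trans uv.1 vz.1.
  by move=> e; move: (lt_asym uv); rewrite e.
case=> -[xy nb]; (split; first by [left|right]); case=> z Vz [bz|bz].
- by apply: nb; exists z.
- exact: down xy bz.1 bz.2.
- exact: down xy bz.1 bz.2.
- by apply: nb; exists z.
Qed.

Lemma covering_edge_sym x y : edge x y -> edge y x.
Proof. by move/covering_edgeP => h; apply/covering_edgeP; tauto. Qed.

Lemma covering_edge_irrefl x : ~ edge x x.
Proof. by case=> -[] [_]. Qed.

Lemma covered_by_unique_pred x y z : V x -> V y -> V z ->
  covered_by x z -> covered_by y z -> x = y.
Proof.
move=> Vx Vy Vz [xz nx] [yz ny]; apply: contrapT => nxy.
case: (lower_chain Vx Vy Vz xz.1 yz.1) => h.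
- by apply: nx; exists y.
- by apply: ny; exists x => //; split=> //; split=> // e; apply: nxy.
Qed.

Lemma covered_by_unique_succ x a b y : V a -> V b -> V y ->
  covered_by x a -> covered_by x b -> le a y -> le b y -> a = b.
Proof.
move=> Va Vb Vy [xa na] [xb nb] ay by_; apply: contrapT => nab.
case: (lower_chain Va Vb Vy ay by_) => h.
- by apply: nb; exists a.
- by apply: na; exists b => //; split=> //; split=> // e; apply: nab.
Qed.

(** If the edge goes down from [a] to [b], then [b] and [x] both lie below [a],
    so they are comparable, [b < x <= a], and there is no room for [x <> a]. *)
Lemma edge_exit x a b : V x -> V a -> V b -> edge a b ->
  le x a -> ~ le x b -> a = x /\ covered_by b x.
Proof.
move=> Vx Va Vb /covering_edgeP ab xa nxb.
case: ab => [[[ab _] _]|ba]; first by case: nxb; apply: le_trans xa ab.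
suff e : a = x by rewrite -e.
apply: contrapT => nax; case: (lower_chain Vx Vb Va xa ba.1.1) => // bx.
apply: ba.2; exists x => //; split; split=> //.
- by move=> e; apply: nxb; rewrite e.
- by move=> e; apply: nax.
Qed.

(** By [edge_exit], the path could leave the elements above [c] only by
    returning to [x]. *)
Lemma path_stays_above x c a p : V x -> V c -> covered_by x c ->
  {in a :: p, forall z, V z} -> le c a ->
  path (fun a b => `[< edge a b >]) a p -> x \notin p -> le c (last a p).
Proof.
move=> Vx Vc xc; elim: p a => [|b p IH] a //= Vabp ca /andP[/asboolP ab pb].
rewrite inE negb_or => /andP[xb xp].
have Va : V a by apply: Vabp; rewrite mem_head.
have Vb : V b by apply: Vabp; rewrite !inE eqxx orbT.
apply: IH => //; first by move=> z zp; apply: Vabp; rewrite inE zp orbT.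
apply: contrapT => ncb; have [_ bc] := edge_exit Vc Va Vb ab ca ncb.
by move/eqP: xb; apply; apply: covered_by_unique_pred xc bc.
Qed.

(** By [edge_exit] read backwards, the path could come back above [x] only
    through [x] itself. *)
Lemma path_stays_outside x a p : V x -> {in a :: p, forall z, V z} ->
  ~ le x a -> path (fun a b => `[< edge a b >]) a p ->
  x \notin p -> ~ le x (last a p).
Proof.
move=> Vx; elim: p a => [|b p IH] a //= Vabp nxa /andP[/asboolP ab pb].
rewrite inE negb_or => /andP[xb xp].
have Va : V a by apply: Vabp; rewrite mem_head.
have Vb : V b by apply: Vabp; rewrite !inE eqxx orbT.
apply: IH => //; first by move=> z zp; apply: Vabp; rewrite inE zp orbT.
move=> lexb; have [e _] := edge_exit Vx Vb Va (covering_edge_sym ab) lexb nxa.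
by rewrite e eqxx in xb.
Qed.

(** Two paths with the same ends cannot start in different directions: after a
    step up to [c] the endpoint lies above [c], hence above [x], while after a
    step down it does not lie above [x].  Two steps up lead to covers of [x]
    below the same endpoint, and two steps down to its only predecessor. *)
Lemma simple_path_unique x y p q :
  graph_path V edge x y p -> graph_path V edge x y q -> p = q.
Proof.
elim: p q x => [|c p IH] [|d q] x //.
- by move=> [_ _ /= -> _] [_ _ /= e]; rewrite -e mem_last.
- by move=> [_ _ /= e u] [_ _ /= xy _]; move: u; rewrite xy -e mem_last.
move=> [Vp /= /andP[/asboolP xc pc] lp /andP[xp up]].
move=> [Vq /= /andP[/asboolP xd pd] lq /andP[xq uq]].
have Vx : V x by apply: Vp; rewrite mem_head.
have Vcp : {in c :: p, forall z, V z}.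
  by move=> z zp; apply: Vp; rewrite inE zp orbT.
have Vdq : {in d :: q, forall z, V z}.
  by move=> z zq; apply: Vq; rewrite inE zq orbT.
have Vc : V c by apply: Vcp; rewrite mem_head.
have Vd : V d by apply: Vdq; rewrite mem_head.
have Vy : V y by rewrite -lp; apply: Vcp; rewrite mem_last.
have nle u : covered_by u x -> ~ le x u.
  by move=> [[ux nux] _] xu; apply: nux; apply: le_anti.
have notin_tl u t : x \notin u :: t -> x \notin t.
  by rewrite inE negb_or => /andP[].
move/notin_tl in xp; move/notin_tl in xq.
have cd : c = d.
  case/covering_edgeP: xc => xc; case/covering_edgeP: xd => xd.
  - apply: (covered_by_unique_succ Vc Vd Vy xc xd).
      by rewrite -lp; apply: path_stays_above xc _ _ pc xp.
    by rewrite -lq; apply: path_stays_above xd _ _ pd xq.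
  - case: (path_stays_outside Vx Vdq (nle _ xd) pd xq).
    rewrite lq -lp; apply: le_trans xc.1.1 _.
    by apply: path_stays_above xc _ _ pc xp.
  - case: (path_stays_outside Vx Vcp (nle _ xc) pc xp).
    rewrite lp -lq; apply: le_trans xd.1.1 _.
    by apply: path_stays_above xd _ _ pd xq.
  - exact: covered_by_unique_pred xc xd.
by rewrite -cd in Vdq pd lq uq *; congr (_ :: _); apply: (IH q c).
Qed.

Lemma joined_refl x : V x -> joined x x.
Proof. by move=> Vx; exists [::]; split=> // z; rewrite inE => /eqP->. Qed.

Lemma joined_edge x y : V x -> V y -> edge x y -> joined x y.
Proof.
move=> Vx Vy xy; exists [:: y]; split=> //=.
  by move=> z; rewrite !inE => /orP[] /eqP->.
by rewrite andbT; apply/asboolP.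
Qed.

Lemma joined_sym x y : joined x y -> joined y x.
Proof.
move=> [p [Vp pp lp]]; exists (rev (belast x p)); split.
- move=> z; rewrite -lp -mem_rev rev_cons revK -lastI; exact: Vp.
- rewrite -lp rev_path; apply: sub_path pp => a b /asboolP ab.
  by apply/asboolP; apply: covering_edge_sym.
- by case: p lp {Vp pp} => [|a p] //= _; rewrite rev_cons last_rcons.
Qed.

Lemma joined_trans x y z : joined x y -> joined y z -> joined x z.
Proof.
move=> [p [Vp pp lp]] [q [Vq pq lq]]; exists (p ++ q); split.
- move=> t; rewrite -cat_cons mem_cat => /orP[/Vp//|tq].
  by apply: Vq; rewrite inE tq orbT.
- by rewrite cat_path pp lp.
- by rewrite last_cat lp.
Qed.

Lemma joined_simple_path x y : joined x y -> exists p, graph_path V edge x y p.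
Proof.
move=> [p [Vp pp lp]]; case/shortenP: pp lp => q pq uq sq lq.
exists q; split=> // z; rewrite inE => /orP[/eqP->|/sq zp].
  by apply: Vp; rewrite mem_head.
by apply: Vp; rewrite inE zp orbT.
Qed.

Hypothesis root_in : V r.
Hypothesis root_least : forall x, V x -> le r x.
Hypothesis bounded_sup : forall (A : set T) z, A `<=` V -> V z ->
  (forall b, A b -> le b z) ->
  exists s, [/\ V s, forall b, A b -> le b s &
    forall t, V t -> (forall b, A b -> le b t) -> le s t].
Hypothesis pred_exists : forall x, V x -> x <> r ->
  exists m, maximal_in lt [set y | V y /\ lt y x] m.
Hypothesis succ_exists : forall x y, V x -> V y -> lt x y ->
  exists m, minimal_in lt [set z | [/\ V z, lt x z & le z y]] m.

(** The predecessor of the supremum is not an upper bound, so some element of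
    the set lies strictly above it; only the supremum itself does. *)
Lemma bounded_set_has_max (A : set T) a z : A a -> A `<=` V -> V z ->
  (forall b, A b -> le b z) ->
  exists2 s, A s & forall b, A b -> le b s.
Proof.
move=> Aa AV Vz Az; have [s [Vs As s_least]] := bounded_sup AV Vz Az.
have [sr|nsr] := pselect (s = r).
  exists a => // b Ab; apply: le_trans (As _ Ab) _.
  by rewrite sr; apply/root_least/AV.
have [m [[Vm ms] mmax]] := pred_exists Vs nsr.
have /existsNP[b /not_implyP[Ab nbm]] : ~ forall b, A b -> le b m.
  by move=> Am; apply: ms.2; apply: le_anti; [case: ms|apply: s_least].
suff bs : b = s by exists b => // c /As; rewrite bs.
apply: contrapT => nbs; apply: (mmax b).
  by split; [apply: AV|split=> //; apply: As].
case: (lower_chain (AV _ Ab) Vm Vs (As _ Ab) ms.1) => // mb.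
by split=> // e; apply: nbm; rewrite e.
Qed.

Lemma root_connected x : V x -> joined r x.
Proof.
move=> Vx; pose A := [set y | [/\ V y, le y x & joined r y]].
have Ar : A r by split; [|apply: root_least|apply: joined_refl].
have AV : A `<=` V by move=> y [].
have Ax y : A y -> le y x by case.
have [s [Vs sx rs] smax] := bounded_set_has_max Ar AV Vx Ax.
have [<- //|nsx] := pselect (s = x).
have [m [[Vm sm mx] mmin]] := succ_exists Vs Vx (conj sx nsx).
exfalso; apply: sm.2; apply: le_anti; first exact: sm.1.
apply: smax; split=> //; apply: joined_trans rs _; apply: joined_edge => //.
apply/covering_edgeP; left; split=> // -[z Vz [sz zm]].
by apply: (mmin z) (zm); split=> //; apply: le_trans zm.1 mx.
Qed.

Lemma cover_graph_rooted_tree : is_rooted_tree V edge r.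
Proof.
split=> //; split; [exact: covering_edge_sym|exact: covering_edge_irrefl|].
move=> x y Vx Vy; have [p xyp] : exists p, graph_path V edge x y p.
  apply: joined_simple_path; apply: joined_trans (root_connected Vy).
  exact/joined_sym/root_connected.
by exists p; split=> // q; apply: simple_path_unique.
Qed.

End CoverGraph.

(** * Refinement of invariant preorders *)

Lemma refines_anti (T : Type) (R S : rel T) :
  refines R S -> refines S R -> R = S.
Proof.
move=> RS SR; apply/funext => u; apply/funext => v.
by apply/idP/idP; [apply: SR|apply: RS].
Qed.

Section Preorders.

Local Open Scope group_scope.

Context (G : groupType).

(** By left invariance a preorder is determined by the set of [x] that precede 1,
    since [u] precedes [v] exactly when [v^-1 * u] precedes 1.  For a preorder
    coarser than [R] this set is closed downwards for [R], and sets closed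
    downwards for a total relation are nested. *)
Lemma coarser_preorders_comparable (R1 R2 R : rel G) :
  left_preorders G R1 -> left_preorders G R2 -> left_preorders G R ->
  refines R1 R -> refines R2 R -> refines R1 R2 \/ refines R2 R1.
Proof.
move=> [_ tr1 li1] [_ tr2 li2] [tot _ _] R1R R2R.
have shift (S : rel G) (u v : G) : left_invariant S ->
    S u v -> S (v^-1 * u) 1.
  by move=> li /(li _ _ v^-1); rewrite mulVg.
have unshift (S : rel G) (u v : G) : left_invariant S ->
    S (v^-1 * u) 1 -> S u v.
  by move=> li /(li _ _ v); rewrite mulVKg mulg1.
apply: contrapT => /not_orP[n12 n21].
apply: n21 => u v uv1; apply: contrapT => nuv2.
apply: n12 => a b ab2; apply: contrapT => nab1.
case/orP: (tot (v^-1 * u) (b^-1 * a)) => h.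
- by apply: nuv2; apply: unshift => //; apply: tr2 (R2R _ _ h) _; apply: shift.
- by apply: nab1; apply: unshift => //; apply: tr1 (R1R _ _ h) _; apply: shift.
Qed.

(** The supremum is the intersection of the relations; its totality is
    inherited from the bound, which it contains. *)
Lemma bounded_preorders_have_sup (ZR A : set (rel G)) (z : rel G) :
  ZR = left_preorders G \/ ZR = bi_preorders G ->
  A `<=` ZR -> ZR z -> (forall b, A b -> refines b z) ->
  exists s, [/\ ZR s, forall b, A b -> refines b s &
    forall t, ZR t -> (forall b, A b -> refines b t) -> refines s t].
Proof.
move=> ZRE AZ Zz Az.
pose s : rel G := fun u v => `[< forall b, A b -> b u v >].
have ls : A `<=` left_preorders G -> left_preorders G z -> left_preorders G s.
  move=> Al [totz _ _]; split.
  - move=> u v; case/orP: (totz u v) => h; apply/orP; [left|right];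
      by apply/asboolP => b Ab; apply: Az.
  - move=> v u w /asboolP uv /asboolP vw; apply/asboolP => b Ab.
    by have [_ trb _] := Al _ Ab; apply: trb (uv _ Ab) (vw _ Ab).
  - move=> u v w /asboolP uv; apply/asboolP => b Ab.
    by have [_ _ lib] := Al _ Ab; apply/lib/uv.
exists s; split.
- case: ZRE AZ Zz => -> AZ; first exact: ls.
  move=> [lz _]; split; first by apply: ls lz => b /AZ[].
  move=> u v w /asboolP uv; apply/asboolP => b Ab.
  by have [_ rib] := AZ _ Ab; apply/rib/uv.
- by move=> b Ab u v /asboolP; apply.
- by move=> t _ At u v tuv; apply/asboolP => b Ab; apply: At.
Qed.

Lemma trivial_preorder_in (ZR : set (rel G)) :
  ZR = left_preorders G \/ ZR = bi_preorders G -> ZR (trivial_preorder G).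
Proof. by case=> ->; do ?split. Qed.

End Preorders.

Theorem proposition2p20 (G : groupType) (ZR : set (rel G))
    (ZR_lr : ZR = left_preorders G \/ ZR = bi_preorders G)
    (H_pred : forall R : rel G, ZR R -> R <> trivial_preorder G ->
       exists M : rel G, maximal_in (@strictly_refines G)
         [set R' | ZR R' /\ strictly_refines R' R] M)
    (H_succ : forall R1 R2 : rel G, ZR R1 -> ZR R2 -> strictly_refines R1 R2 ->
       exists m : rel G, minimal_in (@strictly_refines G)
         [set R' | [/\ ZR R', strictly_refines R1 R' & refines R' R2]] m) :
  is_rooted_tree ZR (covering_edge (@strictly_refines G) ZR)
    (trivial_preorder G).
Proof.
have Zl R : ZR R -> left_preorders G R by case: ZR_lr => -> // -[].
apply: (@cover_graph_rooted_tree (rel G : eqType) (@refines G)) => //.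
- by move=> R u v.
- by move=> R S U RS SU u v /SU /RS.
- by move=> R S; apply: refines_anti.
- move=> R1 R2 R /Zl l1 /Zl l2 /Zl l.
  exact: coarser_preorders_comparable l1 l2 l.
- exact: trivial_preorder_in.
- by move=> A z; apply: bounded_preorders_have_sup.
Qed.
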